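(* Let $\Theta$ be a standard s-substitution, $t$ a standard term, and $p$ a state over the parameters occurring in $\Theta$ and $t$. Then for all parameter assignments $\sigma\in\mathcal S(p)$ we have $\sigma(\mathrm{Ap}(\Theta,t)|_p){\downarrow}=\sigma(t){\downarrow}\,\Theta[\sigma]$, where $\mathrm{Ap}(\Theta,t)|_p=\psi_p(t)\psi_p(\Theta)$.
   Context: Parameters range over natural numbers; numerals are $\bar0,\bar1=s(\bar0),\bar2,\ldots$; a parameter assignment $\sigma$ maps parameters to numerals and evaluates terms built from $\bar0$, parameters, $s$ and $p$ (predecessor, $p(\bar0)=\bar0$). For $k\ge1$, a $k$-ary variable class $X$ is a set of first-order variables $X(\nu_1,\ldots,\nu_k)$ indexed bijectively by $k$-tuples of numerals (distinct classes disjoint); $X(r_1,\ldots,r_k)$ with numeric terms $r_i$ is a variable expression, $\sigma(X(r_1,\ldots,r_k)){\downarrow}=X(\sigma(r_1){\downarrow},\ldots,\sigma(r_k){\downarrow})$. Schematic individual terms are built from constants, variables, variable expressions, first-order function symbols and primitive-recursively defined schematic term symbols $\hat t(s_1,\ldots,s_i,r_1,\ldots,r_j)$; $\sigma(t){\downarrow}$ is the first-order term obtained by evaluating under $\sigma$ and unfolding definitions. Each variable class $X$ of arity $k$ has a fixed parameter list $(m_1,\ldots,m_k)$; $X(r_1,\ldots,r_k)$ is standard if each $r_i\in\{m_i,\bar0,p(m_i),s(m_i)\}$; a standard term has only standard variable expressions. Two variable expressions are parameter-unifiable if some $\sigma$ evaluates them to the same variable. A standard s-substitution is $\Theta=\{A_1\leftarrow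 t_1,\ldots,A_\gamma\leftarrow t_\gamma\}$ with $A_i$ standard variable expressions, $t_i$ standard terms, and $A_i,A_j$ not parameter-unifiable for $i\neq j$; $\Theta[\sigma]=\{\sigma(A_i){\downarrow}\leftarrow\sigma(t_i){\downarrow}\}_i$ (a first-order substitution, applied in the ordinary way to first-order terms). A state over a finite parameter set $\mathcal P$ is a conjunction choosing for each $m\in\mathcal P$ one of: $m=\bar0$; $m\neq\bar0\wedge p(m)=\bar0$; $m\neq\bar0\wedge p(m)\neq\bar0$; $\mathcal S(p)$ is the set of assignments satisfying $p$. $\psi_p$ on a standard variable expression $X(r_1,\ldots,r_k)$ with list $(m_1,\ldots,m_k)$: for each $i$, if $p$ contains $m_i=\bar0$, replace $r_i\in\{m_i,p(m_i),\bar0\}$ by $\bar0$ and $s(m_i)$ by $\bar1$; if $p$ contains $m_i\neq\bar0\wedge p(m_i)=\bar0$, replace $p(m_i)$ by $\bar0$, $m_i$ by $\bar1$, $s(m_i)$ by $\bar2$, leave $\bar0$; otherwise leave $r_i$. $\psi_p$ fixes constants and ordinary variables, is homomorphic over function symbols and individual arguments of schematic symbols (numeric arguments unchanged), and $\psi_p(\Theta)=\{\psi_p(A_i)\leftarrow\psi_p(t_i)\}_i$. For a term $u$ and a set $\Delta=\{B_1\leftarrow u_1,\ldots\}$ with variable expressions $B_j$, $u\Delta$ denotes syntactic application: every occurrence in $u$ of a variable expression syntactically identical to some $B_j$ is replaced by $u_j$. *)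

(* Defs.v *)
From HB Require Import structures.
From mathcomp Require Import all_boot finmap.

Set Implicit Arguments.
Unset Strict Implicit.
Unset Printing Implicit Defensive.

Local Open Scope fset_scope.

(** [P] is the type of parameters, or that of the numeric formals of a
    definition. *)
Inductive numterm (P : Type) : Type :=
| NZero
| NParam of P
| NSucc of numterm P
| NPred of numterm P.

Arguments NZero {P}.

Fixpoint numterm_eqb (P : eqType) (r1 r2 : numterm P) : bool :=
  match r1, r2 with
  | NZero, NZero => true
  | NParam m1, NParam m2 => m1 == m2
  | NSucc r1, NSucc r2 => numterm_eqb r1 r2
  | NPred r1, NPred r2 => numterm_eqb r1 r2
  | _, _ => false
  end.

Lemma numterm_eqP (P : eqType) : Equality.axiom (@numterm_eqb P).
Proof.
elim=> [|m|r IH|r IH] [|m'|r'|r'] /=; try by constructor.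
- by apply: (iffP eqP) => [->|[]].
- by apply: (iffP (IH r')) => [->|[]].
- by apply: (iffP (IH r')) => [->|[]].
Qed.

HB.instance Definition _ (P : eqType) :=
  hasDecEq.Build (numterm P) (@numterm_eqP P).

(** Numerals are identified with natural numbers; [.-1] sends 0 to 0. *)
Fixpoint neval (P : Type) (sigma : P -> nat) (r : numterm P) : nat :=
  match r with
  | NZero => 0
  | NParam m => sigma m
  | NSucc r => (neval sigma r).+1
  | NPred r => (neval sigma r).-1
  end.

Fixpoint nparams (P : choiceType) (r : numterm P) : {fset P} :=
  match r with
  | NZero => fset0
  | NParam m => [fset m]
  | NSucc r => nparams r
  | NPred r => nparams r
  end.

(** The set [{lhs i <- rhs i | i < bsize}].  [lookup] is unambiguous when the
    left-hand sides are distinct, as they are for the images under [psi_p] and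
    under a satisfying assignment of a standard s-substitution. *)
Record bindings (V T : Type) := Bindings {
  bsize : nat;
  lhs : 'I_bsize -> V;
  rhs : 'I_bsize -> T
}.

Arguments lhs {V T} b i.
Arguments rhs {V T} b i.

Definition map_bindings (V T V' T' : Type) (g : V -> V') (h : T -> T')
    (b : bindings V T) : bindings V' T' :=
  Bindings (fun i => g (lhs b i)) (fun i => h (rhs b i)).

Definition lookup (V : eqType) (T : Type) (b : bindings V T) (u : T) (x : V)
    : T :=
  if [pick i | lhs b i == x] is Some i then rhs b i else u.

(** Constants are the function symbols of arity 0.  A schematic term symbol [f]
    takes [tsym_iarity f] individual arguments and [(tsym_narity f).+1] numeric
    ones; the last numeric argument is the one its definition recurses on.
    [tsym_prec g f] means that [g] may be used in the definition of [f]. *)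
Record language := Language {
  param : choiceType;
  ovar : eqType;
  fsym : Type;
  fsym_arity : fsym -> nat;
  vclass : eqType;
  vclass_arity : vclass -> nat;
  vclass_arity_gt0 : forall X, 0 < vclass_arity X;
  vclass_params : forall X, 'I_(vclass_arity X) -> param;
  tsym : Type;
  tsym_iarity : tsym -> nat;
  tsym_narity : tsym -> nat;
  tsym_prec : tsym -> tsym -> Prop;
  tsym_prec_wf : well_founded tsym_prec
}.

Arguments fsym_arity {l}.
Arguments vclass_arity {l}.
Arguments vclass_params {l}.
Arguments tsym_iarity {l}.
Arguments tsym_narity {l}.
Arguments tsym_prec {l}.
Arguments tsym_prec_wf {l}.

Section Syntax.

Variable L : language.

Definition assignment := param L -> nat.

(** [Tagged _ nu : cvar] at tag [X] is the variable X(nu_1, ..., nu_k), and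
    similarly for the variable expressions [vexp] below. *)
Definition cvar : eqType := {X : vclass L & {ffun 'I_(vclass_arity X) -> nat}}.

Definition fovar : eqType := (ovar L + cvar)%type.

Inductive foterm : Type :=
| FVar of fovar
| FFun (f : fsym L) of {ffun 'I_(fsym_arity f) -> foterm}.

Definition vexp : eqType :=
  {X : vclass L & {ffun 'I_(vclass_arity X) -> numterm (param L)}}.

Inductive sterm : Type :=
| SVar of ovar L
| SVexp of vexp
| SFun (f : fsym L) of {ffun 'I_(fsym_arity f) -> sterm}
| SSym (f : tsym L) of {ffun 'I_(tsym_iarity f) -> sterm} &
    {ffun 'I_(tsym_narity f) -> numterm (param L)} & numterm (param L).

(** Right-hand sides of the defining equations of [f]: terms over individual
    formals [I] and numeric formals [N] which use only the symbols below [f].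
    Their only variables and parameters are the formals. *)
Inductive body (f : tsym L) (I N : Type) : Type :=
| BArg of I
| BFun (g : fsym L) of {ffun 'I_(fsym_arity g) -> body f I N}
| BSym (g : tsym L) of tsym_prec g f &
    {ffun 'I_(tsym_iarity g) -> body f I N} &
    {ffun 'I_(tsym_narity g) -> numterm N} & numterm N.

(** The equations
      f(x, n, 0)    = def_base f
      f(x, n, s(m)) = (def_step f){xi <- f(x, n, m)};
    in [def_step f] the individual formal [None] is xi and the numeric formal
    [None] is m. *)
Record definitions := Definitions {
  def_base : forall f : tsym L,
    body f 'I_(tsym_iarity f) 'I_(tsym_narity f);
  def_step : forall f : tsym L,
    body f (option 'I_(tsym_iarity f)) (option 'I_(tsym_narity f))
}.

Definition tsym_value (f : tsym L) : Type :=
  {ffun 'I_(tsym_iarity f) -> foterm} ->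
  {ffun 'I_(tsym_narity f) -> nat} -> nat -> foterm.

Fixpoint beval (f : tsym L) (call : forall g, tsym_prec g f -> tsym_value g)
    (I N : Type) (x : I -> foterm) (n : N -> nat) (b : body f I N) : foterm :=
  match b with
  | BArg i => x i
  | BFun g a => FFun [ffun i => beval call x n (a i)]
  | BSym g lt_gf a r r0 =>
      call g lt_gf [ffun i => beval call x n (a i)]
        [ffun j => neval n (r j)] (neval n r0)
  end.

(** The first-order term to which f(x, n, k) unfolds. *)
Definition tsym_unfold (D : definitions) : forall f, tsym_value f :=
  Fix tsym_prec_wf tsym_value (fun f call x n =>
    nat_rect (fun=> foterm)
      (beval call x n (def_base D f))
      (fun m xi => beval call (oapp x xi) (oapp n m) (def_step D f))).

Definition veval (sigma : assignment) (A : vexp) : cvar :=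
  Tagged (fun X => {ffun 'I_(vclass_arity X) -> nat})
    [ffun i => neval sigma (tagged A i)].

Fixpoint seval (D : definitions) (sigma : assignment) (t : sterm) : foterm :=
  match t with
  | SVar x => FVar (inl x)
  | SVexp A => FVar (inr (veval sigma A))
  | SFun f a => FFun [ffun i => seval D sigma (a i)]
  | SSym f a r r0 =>
      tsym_unfold D [ffun i => seval D sigma (a i)]
        [ffun j => neval sigma (r j)] (neval sigma r0)
  end.

Definition vparams (A : vexp) : {fset param L} :=
  \big[fsetU/fset0]_i nparams (tagged A i).

Fixpoint sparams (t : sterm) : {fset param L} :=
  match t with
  | SVar _ => fset0
  | SVexp A => vparams A
  | SFun f a => \big[fsetU/fset0]_i sparams (a i)
  | SSym f a r r0 =>
      (\big[fsetU/fset0]_i sparams (a i)) `|`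
      (\big[fsetU/fset0]_j nparams (r j)) `|` nparams r0
  end.

Definition standard_vexp (A : vexp) : Prop :=
  forall i, let m := NParam (vclass_params (tag A) i) in
    tagged A i \in [:: m; NZero; NPred m; NSucc m].

Fixpoint standard (t : sterm) : Prop :=
  match t with
  | SVar _ => True
  | SVexp A => standard_vexp A
  | SFun f a => forall i, standard (a i)
  | SSym f a _ _ => forall i, standard (a i)
  end.

Definition param_unifiable (A B : vexp) : Prop :=
  exists sigma : assignment, veval sigma A = veval sigma B.

Definition ssubst := bindings vexp sterm.

Definition standard_ssubst (Theta : ssubst) : Prop :=
  [/\ forall i, standard_vexp (lhs Theta i),
      forall i, standard (rhs Theta i) &
      forall i j, i != j -> ~ param_unifiable (lhs Theta i) (lhs Theta j)].

Definition ssubst_params (Theta : ssubst) : {fset param L} :=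
  \big[fsetU/fset0]_i (vparams (lhs Theta i) `|` sparams (rhs Theta i)).

Fixpoint ssubst_apply (Delta : ssubst) (t : sterm) : sterm :=
  match t with
  | SVar x => SVar x
  | SVexp A => lookup Delta (SVexp A) A
  | SFun f a => SFun [ffun i => ssubst_apply Delta (a i)]
  | SSym f a r r0 => SSym [ffun i => ssubst_apply Delta (a i)] r r0
  end.

Definition fosubst := bindings fovar foterm.

Fixpoint fosubst_apply (theta : fosubst) (t : foterm) : foterm :=
  match t with
  | FVar x => lookup theta (FVar x) x
  | FFun f a => FFun [ffun i => fosubst_apply theta (a i)]
  end.

(** Theta[sigma] *)
Definition ssubst_inst (D : definitions) (sigma : assignment) (Theta : ssubst)
    : fosubst :=
  map_bindings (fun A => inr (veval sigma A)) (seval D sigma) Theta.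

(** The conjuncts m = 0; m <> 0 /\ p(m) = 0; m <> 0 /\ p(m) <> 0. *)
Inductive pcase := CZero | COne | CMore.

Definition pcase_holds (c : pcase) (k : nat) : Prop :=
  match c with
  | CZero => k = 0
  | COne => k <> 0 /\ k.-1 = 0
  | CMore => k <> 0 /\ k.-1 <> 0
  end.

(** [domf p] is the parameter set that the state [p] is over. *)
Definition state := {fmap param L -> pcase}.

Definition satisfies (p : state) (sigma : assignment) : Prop :=
  forall m c, p.[? m]%fmap = Some c -> pcase_holds c (sigma m).

Definition psi_num (p : state) (m : param L) (r : numterm (param L))
    : numterm (param L) :=
  let num1 := NSucc NZero in
  let num2 := NSucc num1 in
  match p.[? m]%fmap with
  | Some CZero =>
      if r \in [:: NParam m; NPred (NParam m); NZero] then NZero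
      else if r == NSucc (NParam m) then num1 else r
  | Some COne =>
      if r == NPred (NParam m) then NZero
      else if r == NParam m then num1
      else if r == NSucc (NParam m) then num2 else r
  | _ => r
  end.

Definition psi_vexp (p : state) (A : vexp) : vexp :=
  Tagged (fun X => {ffun 'I_(vclass_arity X) -> numterm (param L)})
    [ffun i => psi_num p (vclass_params (tag A) i) (tagged A i)].

Fixpoint psi (p : state) (t : sterm) : sterm :=
  match t with
  | SVar x => SVar x
  | SVexp A => SVexp (psi_vexp p A)
  | SFun f a => SFun [ffun i => psi p (a i)]
  | SSym f a r r0 => SSym [ffun i => psi p (a i)] r r0
  end.

Definition psi_ssubst (p : state) (Theta : ssubst) : ssubst :=
  map_bindings (psi_vexp p) (psi p) Theta.

(** Ap(Theta, t)|_p *)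
Definition Ap (Theta : ssubst) (t : sterm) (p : state) : sterm :=
  ssubst_apply (psi_ssubst p Theta) (psi p t).

End Syntax.

(* Main.v *)
(** Over [S(p)], [psi p] does not change the value of a term, and two standard
    variable expressions over the parameters of [p] denote the same variable
    exactly when their images under [psi p] are syntactically identical: in the
    third case of a state, m >= 2 makes 0, m - 1, m and m + 1 distinct, and the
    first two cases replace everything by numerals.  So syntactic application of
    [psi p Theta] and first-order application of [Theta[sigma]] select the same
    bindings; it remains to observe that unfolding schematic symbols commutes
    with first-order substitution, as bodies contain no free variables. *)
Require Import Defs.
From mathcomp Require Import all_boot finmap zify.

Set Implicit Arguments.
Unset Strict Implicit.
Unset Printing Implicit Defensive.

Local Open Scope fset_scope.

Lemma subset_bigfsetU (I : finType) (K : choiceType) (F : I -> {fset K})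
    (A : {fset K}) :
  \big[fsetU/fset0]_i F i `<=` A -> forall i, F i `<=` A.
Proof. by move=> sFA i; apply: fsubset_trans sFA; apply: bigfcup_sup. Qed.

Section Substitution.

Variables (L : language) (D : definitions L) (theta : fosubst L).

(** A body has no variables besides its formals, so [theta] acts only through the values given to
    them; [call_subst] covers the symbols below [f]. *)
Lemma fosubst_beval (f : tsym L)
    (call : forall g, tsym_prec g f -> tsym_value g)
    (call_subst : forall g (lt_gf : tsym_prec g f) x n k,
      fosubst_apply theta (call g lt_gf x n k) =
      call g lt_gf [ffun i => fosubst_apply theta (x i)] n k)
    (I N : Type) (x x' : I -> foterm L) (n : N -> nat)
    (xx' : forall i, fosubst_apply theta (x i) = x' i) :
  forall b : body f I N,
    fosubst_apply theta (beval call x n b) = beval call x' n b.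
Proof.
(* Structural recursion by hand, since the subterms lie under a finite function. *)
fix IH 1; case=> [i|g a|g lt_gf a r r0] /=; first exact: xx'.
- by congr FFun; apply/ffunP=> i; rewrite !ffunE; apply: IH.
- rewrite call_subst; congr (call g lt_gf _ _ _).
  by apply/ffunP=> i; rewrite !ffunE; apply: IH.
Qed.

Lemma fosubst_tsym_unfold (f : tsym L) x n k :
  fosubst_apply theta (@tsym_unfold L D f x n k) =
  @tsym_unfold L D f [ffun i => fosubst_apply theta (x i)] n k.
Proof.
(* [Fix] recurses on the accessibility proof; generalising and then destructing that proof exposes
   one unfolding. *)
rewrite /tsym_unfold /Fix; move: (@tsym_prec_wf L f) => acc_f.
elim/(well_founded_ind (@tsym_prec_wf L)): f acc_f x n k => f IH [acc_f] x n /=.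
elim=> [|k IHk] /=; apply: fosubst_beval => [g lt_gf *|].
- exact: IH.
- by move=> i; rewrite ffunE.
- exact: IH.
(* The formal [None] holds the value at [k], which [IHk] handles. *)
- by case=> [i|] //=; rewrite ffunE.
Qed.

End Substitution.

Section State.

Variables (L : language) (D : definitions L).
Variables (p : state L) (sigma : assignment L).
Hypothesis sat : satisfies p sigma.

Lemma neval_psi_num m r : neval sigma (psi_num p m r) = neval sigma r.
Proof.
rewrite /psi_num; case pm: (p.[? m])%fmap => [[]|] //; have := sat pm.
- move=> /= m0; case: ifP => [|_].
    by rewrite !inE => /or3P[]/eqP-> /=; rewrite ?m0.
  by case: eqP => [->|//] /=; rewrite m0.
- move=> /= m1; do !(case: eqP => [->|_] /=); lia.
Qed.

Lemma veval_psi_vexp A : veval sigma (psi_vexp p A) = veval sigma A.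
Proof.
by congr Tagged; apply/ffunP=> i; rewrite !ffunE neval_psi_num.
Qed.

Lemma seval_psi : forall t : sterm L, seval D sigma (psi p t) = seval D sigma t.
Proof.
fix IH 1; case=> [x|A|f a|f a r r0] //=.
- by rewrite veval_psi_vexp.
- by congr FFun; apply/ffunP=> i; rewrite !ffunE; apply: IH.
- by congr tsym_unfold; apply/ffunP=> i; rewrite !ffunE; apply: IH.
Qed.

(* If [m] is outside the domain of [p], then both [r] and [r'] are 0. *)
Lemma psi_num_inj m r r' :
    r \in [:: NParam m; NZero; NPred (NParam m); NSucc (NParam m)] ->
    r' \in [:: NParam m; NZero; NPred (NParam m); NSucc (NParam m)] ->
    nparams r `<=` domf p -> nparams r' `<=` domf p ->
  neval sigma r = neval sigma r' -> psi_num p m r = psi_num p m r'.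
Proof.
rewrite /psi_num; case: fndP => [mp|mNp].
  have := sat (in_fnd mp); case: (p.[mp])%fmap => /= Hm;
  rewrite !inE => /or4P[]/eqP-> /or4P[]/eqP-> _ _ //=;
  rewrite ?inE /= ?eqxx //=; try lia.
by rewrite !inE => /or4P[]/eqP-> /or4P[]/eqP-> //=;
  rewrite ?fsub1set (negPf mNp).
Qed.

Lemma psi_vexp_eq (A B : vexp L) :
    standard_vexp A -> standard_vexp B ->
    vparams A `<=` domf p -> vparams B `<=` domf p ->
  (psi_vexp p A == psi_vexp p B) = (veval sigma A == veval sigma B).
Proof.
move=> stA stB pA pB; apply/eqP/eqP => [eqAB|].
  by rewrite -veval_psi_vexp eqAB veval_psi_vexp.
case: A B stA stB pA pB => [X a] [Y b] stA stB pA pB eqAB.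
(* The index type depends on the class, so the classes are identified before coordinates are
   compared. *)
have eqXY : X = Y := congr1 tag eqAB; case: Y / eqXY in b stB pB eqAB *.
have /ffunP eqab := eq_from_Tagged eqAB.
congr Tagged; apply/ffunP=> i; rewrite !ffunE; apply: psi_num_inj.
- exact: stA.
- exact: stB.
- exact: (subset_bigfsetU pA).
- exact: (subset_bigfsetU pB).
- by have := eqab i; rewrite !ffunE.
Qed.

Variable Theta : ssubst L.
Hypothesis standard_lhs : forall i, standard_vexp (lhs Theta i).
Hypothesis params_lhs : forall i, vparams (lhs Theta i) `<=` domf p.

Lemma seval_lookup_psi A : standard_vexp A -> vparams A `<=` domf p ->
  seval D sigma (lookup (psi_ssubst p Theta) (SVexp (psi_vexp p A))
    (psi_vexp p A)) =
  lookup (ssubst_inst D sigma Theta) (FVar (inr (veval sigma A)))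
    (inr (veval sigma A)).
Proof.
move=> stA pA; rewrite /lookup /=.
(* Both lookups range over the indices of [Theta], so equal tests pick the same binding. *)
have eq_sel : (fun i => psi_vexp p (lhs Theta i) == psi_vexp p A) =1
    (fun i => inr (veval sigma (lhs Theta i)) == inr (veval sigma A) :> fovar L).
  by move=> i; rewrite psi_vexp_eq.
rewrite (eq_pick eq_sel); case: pickP => [i _|_] /=; first exact: seval_psi.
by rewrite veval_psi_vexp.
Qed.

Lemma seval_Ap : forall t : sterm L, standard t -> sparams t `<=` domf p ->
  seval D sigma (Ap Theta t p) =
  fosubst_apply (ssubst_inst D sigma Theta) (seval D sigma t).
Proof.
rewrite /Ap; fix IH 1; case=> [x|A|f a|f a r r0] /=.
(* Every variable bound by [ssubst_inst] is an [inr], hence never an ordinary one. *)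
- by rewrite /lookup; case: pickP => // i /eqP.
- exact: seval_lookup_psi.
- move=> sta pa; congr FFun; apply/ffunP=> i; rewrite !ffunE.
  exact: IH (sta i) (subset_bigfsetU pa i).
- rewrite !fsubUset -andbA => sta /and3P[pa _ _].
  rewrite fosubst_tsym_unfold; congr tsym_unfold.
  apply/ffunP=> i; rewrite !ffunE.
  exact: IH (sta i) (subset_bigfsetU pa i).
Qed.

End State.

Theorem theorem1 (L : language) (D : definitions L)
    (Theta : ssubst L) (t : sterm L) (p : state L)
    (HTheta : standard_ssubst Theta) (Ht : standard t)
    (Hp : domf p = (ssubst_params Theta `|` sparams t)%fset) :
  forall sigma : assignment L, satisfies p sigma ->
    seval D sigma (Ap Theta t p) =
    fosubst_apply (ssubst_inst D sigma Theta) (seval D sigma t).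
Proof.
move=> sigma sat; case: HTheta => st_lhs _ _.
apply: seval_Ap => // [i|]; last by rewrite Hp fsubsetUr.
have pTheta : ssubst_params Theta `<=` domf p by rewrite Hp fsubsetUl.
by have := subset_bigfsetU pTheta i; rewrite fsubUset => /andP[].
Qed.
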